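(* A weakly quasi-transitive digraph $D$ is chordal if and only if $S(D)$ is chordal and $D$ does not contain any of the digraphs $F_a, F_b, F_c, F_d$ described in the context as an induced subdigraph.
   Context: Digraphs are finite, have no loops and no multiple arcs, but may contain digons; an arc lying in a digon is called symmetric, otherwise non-symmetric. $N^-(v)$ / $N^+(v)$ denote the sets of in-/out-neighbours of $v$; two vertices are adjacent if there is at least one arc between them. A vertex $v$ is di-simplicial if for every $u \in N^-(v)$ and $w \in N^+(v)$ with $u \neq w$, $uw$ is an arc. A digraph is chordal if every induced subdigraph contains a di-simplicial vertex. $S(D)$ is the spanning subdigraph of $D$ consisting of all symmetric arcs of $D$. Two neighbours $u,w$ of $v$ are synchronous neighbours of $v$ if both lie in $N^-(v)\setminus N^+(v)$, or both in $N^+(v)\setminus N^-(v)$, or both in $N^-(v)\cap N^+(v)$; otherwise they are asynchronous. A digraph is weakly quasi-transitive if for each vertex $v$, any two asynchronous neighbours of $v$ are adjacent. The digraphs $F_a,F_b,F_c$ have vertex set $\{1,2,3,4\}$ with symmetric arcs $1\leftrightarrow 3$ and $2 \leftrightarrow 4$, plus: $F_a$: non-symmetric arcs $1\to2$, $2\to3$, $4\to1$ and symmetric arc $3\leftrightarrow4$; $F_b$: non-symmetric arcs $1\to2$, $2\to3$, $3\to4$, $4\to1$; $F_c$: non-symmetric arcs $1\to2$, $2\to3$, $4\to3$, $4\to1$. $F_d$ is the directed 3-cycle $1\to2\to3\to1$ with all arcs non-symmetric. *)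

(* Defs.v *)
(* A digraph on a finite vertex type T is an arc relation
   A : rel T with no loops (irreflexive A); a relation has no multiple arcs. *)
From mathcomp Require Import all_boot.
Set Implicit Arguments. Unset Strict Implicit. Unset Printing Implicit Defensive.

Section Digraphs.
Variable T : finType.
Variable A : rel T.

Definition disimplicial_in (S : {set T}) (v : T) : Prop :=
  forall u w, u \in S -> w \in S -> A u v -> A v w -> u != w -> A u w.

Definition chordal : Prop :=
  forall S : {set T}, S != set0 -> exists2 v, v \in S & disimplicial_in S v.

Definition sym_part : rel T := fun u v => A u v && A v u.

Definition adjacent (u v : T) : bool := A u v || A v u.

(* neighbour type of u w.r.t. v: 0 = in-only, 1 = out-only, 2 = both *)
Definition nb_class (v u : T) : nat :=
  if A u v && A v u then 2 else if A u v then 0 else 1.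

Definition asynchronous (v u w : T) : Prop :=
  adjacent v u /\ adjacent v w /\ nb_class v u <> nb_class v w.

Definition weakly_quasi_transitive : Prop :=
  forall v u w, asynchronous v u w -> adjacent u w.

Definition has_induced (n : nat) (F : rel 'I_n) : Prop :=
  exists f : 'I_n -> T, injective f /\ forall i j, A (f i) (f j) = F i j.

End Digraphs.

(* digraphs given by arc lists; vertex k of the paper is index k-1 *)
Definition rel_of_arcs (n : nat) (arcs : seq (nat * nat)) : rel 'I_n :=
  fun i j => (nat_of_ord i, nat_of_ord j) \in arcs.

Definition F_a : rel 'I_4 := @rel_of_arcs 4
  [:: (0,2); (2,0); (1,3); (3,1); (0,1); (1,2); (3,0); (2,3); (3,2)].
Definition F_b : rel 'I_4 := @rel_of_arcs 4
  [:: (0,2); (2,0); (1,3); (3,1); (0,1); (1,2); (2,3); (3,0)].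
Definition F_c : rel 'I_4 := @rel_of_arcs 4
  [:: (0,2); (2,0); (1,3); (3,1); (0,1); (1,2); (3,2); (3,0)].
Definition F_d : rel 'I_3 := @rel_of_arcs 3 [:: (0,1); (1,2); (2,0)].

(* Main.v *)
Require Import Defs.
From mathcomp Require Import all_boot.

Set Implicit Arguments. Unset Strict Implicit. Unset Printing Implicit Defensive.

(** Write S for the symmetric arcs and P for the non-symmetric ones.  Say that
    b attacks a when a and b lie on a triangle a -> b -> c or c -> b -> a with
    a <-> c.  Given weak quasi-transitivity and no F_d, a vertex is
    di-simplicial iff it is simplicial in S(D) and not attacked, and excluding
    F_a, F_b, F_c means exactly that no two vertices attack each other.
    An attack of b on a with a -> b enlarges the set of P-in-neighbours, an
    attack with b -> a enlarges the set of P-out-neighbours, and two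
    consecutive attacks of opposite directions starting at a simplicial vertex
    compose into one attack.  Hence attacks among the simplicial vertices are
    acyclic.  Finally, by chordality of S(D), an attacked simplicial vertex is
    attacked by a simplicial vertex, so some simplicial vertex is not attacked. *)

(** * Simplicial vertices of chordal undirected graphs *)

Section SimplicialVertices.
Variables (T : finType) (S : rel T).
Hypotheses (S_sym : symmetric S) (S_chordal : chordal S).

Lemma disimplicial_inW (U W : {set T}) x :
    disimplicial_in S W x -> (forall y, y \in U -> S x y -> y \in W) ->
  disimplicial_in S U x.
Proof.
move=> simpx subW u w Uu Uw Sux Sxw; apply: simpx => //; apply: subW => //.
by rewrite S_sym.
Qed.

(** Dirac's theorem, by deleting a simplicial vertex [s]: a non-neighbour of [s] that is simplicial
    without [s] remains so with it, and two non-adjacent vertices are not both neighbours of [s]. *)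
Lemma two_simplicial (U : {set T}) :
    (forall x y, x \in U -> y \in U -> x != y -> S x y) \/
  exists x y, [/\ x \in U, y \in U, x != y & ~~ S x y] /\
    disimplicial_in S U x /\ disimplicial_in S U y.
Proof.
have [n] := ubnP #|U|; elim: n U => // n IHn U leUn.
have [->|U0] := eqVneq U set0; first by left=> x y; rewrite inE.
have [s Us simps] := S_chordal U0.
have leUs : #|U :\ s| < n by move: leUn; rewrite (cardsD1 s U) Us.
have simpU x : x \in U -> x != s -> ~~ S x s ->
    disimplicial_in S (U :\ s) x -> disimplicial_in S U x.
  move=> Ux xs Sxs /disimplicial_inW; apply=> y Uy Sxy.
  by rewrite !inE Uy andbT; apply: contraNneq Sxs => <-.
case: (IHn _ leUs) => [clq | [x [y [[]]]]].
  have [/forallP adjs | /forallPn[t]] :=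
      boolP [forall t, (t \in U) && (t != s) ==> S t s].
    left=> x y Ux Uy xy; have [eqxs|xs] := eqVneq x s.
      have := adjs y; rewrite Uy -eqxs eq_sym xy /=; by rewrite S_sym.
    have [->|ys] := eqVneq y s; first by have := adjs x; rewrite Ux xs.
    by apply: clq => //; rewrite !inE ?xs ?ys.
  rewrite negb_imply => /andP[/andP[Ut ts] Sts].
  right; exists s, t; split; first by rewrite eq_sym S_sym; split.
  split=> //; apply: simpU => // u w Uu Uw _ _; exact: clq.
rewrite !inE => /andP[xs Ux] /andP[ys Uy] xy Sxy [simpx simpy].
right; have [Sxs|Sxs] := boolP (S x s); last first.
  by exists s, x; rewrite eq_sym S_sym; do !split=> //; apply: simpU.
exists s, y; have Sys : ~~ S y s.
  by apply: contra Sxy => Sys; apply: simps => //; rewrite S_sym.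
by rewrite eq_sym S_sym; do !split=> //; apply: simpU.
Qed.

(** Here [X] is a union of components of [U] minus the closed neighbourhood of [c]. Simplicial
    vertices are deleted until one lies in [X] or is [c] itself. *)
Lemma simplicial_away (U X : {set T}) c :
    c \in U -> X \subset U -> X != set0 ->
    (forall x, x \in X -> x != c /\ ~~ S x c) ->
    (forall x y, x \in X -> y \in U -> S x y -> y \in X \/ S y c) ->
  exists2 x, x \in X & disimplicial_in S U x.
Proof.
have [n] := ubnP #|U|; elim: n U => // n IHn U leUn Uc sXU X0 Xc clX.
have U0 : U != set0 by apply/set0Pn; exists c.
have [s Us simps] := S_chordal U0.
have [Xs|Xs] := boolP (s \in X); first by exists s.
have [eqsc|sc] := eqVneq s c.
  (* The neighbours of X outside X are neighbours of c, hence form a clique. *)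
  pose W := X :|: [set y in U | S y c].
  have clW x : x \in X -> forall y, y \in U -> S x y -> y \in W.
    by move=> Xx y Uy /(clX _ _ Xx Uy); rewrite !inE Uy => -[->|->]; rewrite ?orbT.
  have simpU x : x \in X -> disimplicial_in S W x ->
      exists2 x, x \in X & disimplicial_in S U x.
    by move=> Xx simpx; exists x => //; apply: disimplicial_inW simpx (clW _ Xx).
  case: (two_simplicial W) => [clq|[x [y [[Wx Wy xy Sxy] [simpx simpy]]]]].
    have /set0Pn[x Xx] := X0; apply: (simpU x Xx) => u w Wu Ww _ _; exact: clq.
  have [Xx|Xx] := boolP (x \in X); first exact: simpU simpx.
  have [Xy|Xy] := boolP (y \in X); first exact: simpU simpy.
  move: Wx Wy; rewrite !inE (negPf Xx) (negPf Xy) /= => /andP[Ux Sx] /andP[Uy Sy].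
  by case/negP: Sxy; apply: simps; rewrite ?eqsc // S_sym.
have [||||x Xx simpx] := IHn (U :\ s) _ _ _ X0 Xc.
- by move: leUn; rewrite (cardsD1 s U) Us.
- by rewrite !inE eq_sym sc.
- by rewrite subsetD1 sXU.
- by move=> x y Xx /setD1P[_ Uy]; apply: clX.
exists x => //; apply: disimplicial_inW simpx _ => y Uy Sxy.
(* The deleted [s] has no neighbour in [X]: lying outside [X] it would be a neighbour of [c], and
   its simpliciality would join [x] to [c]. *)
rewrite !inE Uy andbT; apply: contraTneq Sxy => ->; apply/negP => Sxs.
have [xc Sxc] := Xc x Xx.
have [|Ssc] := clX x s Xx Us Sxs; first exact/negP.
by case/negP: Sxc; apply: simps; rewrite // (subsetP sXU).
Qed.

End SimplicialVertices.

(** * Attacks between vertices *)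

Section Attacks.
Variable T : finType.

Definition tri (S P : rel T) : rel T := fun u v => [|| P u v, P v u | S u v].

(* The last clause is the common content of excluding F_a, F_b and F_c. *)
Record attack_antisym (S P : rel T) : Prop := AttackAntisym {
  aa_sym : symmetric S;
  aa_Pirr : irreflexive P;
  aa_PS : forall x y, P x y -> S x y -> False;
  aa_triPS : forall u v w, P u v -> S v w -> tri S P u w;
  aa_triSP : forall u v w, P v u -> S v w -> tri S P u w;
  aa_triPP : forall u v w, P u v -> P v w -> tri S P u w;
  aa_nocycle : forall u v w, P u v -> P v w -> P w u -> False;
  aa_noF : forall a b c d,
    P a b -> S a c -> P b c -> S b d -> P d a -> False }.

(** Results on [attacks] thus carry over to [rattacks]. The configuration of [aa_noF] is self-dual:
    reversal swaps [a] with [b] and [c] with [d]. *)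
Lemma attack_antisym_rev (S P : rel T) :
  attack_antisym S P -> attack_antisym S (fun x y => P y x).
Proof.
case=> symS irrP PS tPS tSP tPP ncyc noF.
have triC u v : tri S P u v -> tri S (fun x y => P y x) u v.
  by rewrite /tri orbCA.
split=> //.
- by move=> x y Pyx; rewrite symS; apply: PS.
- by move=> u v w Pvu Svw; apply/triC/(tSP u v w).
- by move=> u v w Puv Svw; apply/triC/(tPS u v w).
- move=> u v w Pvu Pwv; apply: triC; move: (tPP w v u Pwv Pvu).
  by rewrite /tri symS orbCA.
- by move=> u v w Pvu Pwv Puw; apply: (ncyc u w v).
- by move=> a b c d Pba Sac Pcb Sbd Pad; apply: (noF b a d c).
Qed.

Definition attacks (S P : rel T) (U : {set T}) (b a : T) : bool :=
  [exists c in U, [&& S a c, P a b & P b c]].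

Definition rattacks (S P : rel T) (U : {set T}) : rel T :=
  attacks S (fun x y => P y x) U.

Lemma attacksP (S P : rel T) (U : {set T}) b a :
  reflect (exists c, [/\ c \in U, S a c, P a b & P b c]) (attacks S P U b a).
Proof.
apply: (iffP (exists_inP)) => [[c Uc /and3P[]]|[c []]]; first by exists c.
by move=> Uc Sac Pab Pbc; exists c => //; apply/and3P.
Qed.

(** If [a -> b -> d], then [a] and [d] are adjacent; [d -> a] closes a directed triangle and
    [a <-> d] makes [b] and [d] attack each other, so [a -> d]. The vertex [b] itself makes the
    inclusion strict. *)
Lemma attacks_indegree (S P : rel T) (U : {set T}) b d :
  attack_antisym S P -> attacks S P U d b ->
  #|[set a | P a b]| < #|[set a | P a d]|.
Proof.
move=> aa /attacksP[e [_ Sbe Pbd Pde]]; apply/proper_card/properP; split.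
  apply/subsetP=> a; rewrite !inE => Pab.
  case/or3P: (aa_triPP aa Pab Pbd) => // [Pda|Sad].
    by case: (aa_nocycle aa Pab Pbd Pda).
  by case: (aa_noF aa Pbd Sbe Pde _ Pab); rewrite (aa_sym aa).
by exists b; rewrite inE ?(aa_Pirr aa).
Qed.

(** Let [b -> d -> e] and [a -> b -> c] be the two triangles. Then [a -> d], so [c] and [d] are
    adjacent; [d -> c] is an attack with witness [a], and [c -> d] one with witness [e]. *)
Lemma attacks_comp (S P : rel T) (U : {set T}) d b c :
    attack_antisym S P -> d \in U -> disimplicial_in S U c ->
    attacks S P U d b -> rattacks S P U b c ->
  attacks S P U d c || rattacks S P U d c.
Proof.
move=> aa Ud simpc /attacksP[e [Ue Sbe Pbd Pde]] /attacksP[a [Ua Sca Pbc Pab]].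
have Sac : S a c by rewrite (aa_sym aa).
have Seb : S e b by rewrite (aa_sym aa).
have Pad : P a d.
  case/or3P: (aa_triPP aa Pab Pbd) => // [Pda|Sad].
    by case: (aa_nocycle aa Pab Pbd Pda).
  by case: (aa_noF aa Pbd Sbe Pde _ Pab); rewrite (aa_sym aa).
have nPce : P c e -> False by move=> Pce; apply: (aa_noF aa Pbc Sbe Pce Sca Pab).
have triec := aa_triSP aa Pbc Sbe.
case/or3P: (aa_triSP aa Pad Sac) => [Pdc|Pcd|Sdc].
- by apply/orP; right; apply/attacksP; exists a.
- case/or3P: triec => [/nPce//|Pec|Sce].
    by case: (aa_nocycle aa Pcd Pde Pec).
  by apply/orP; left; apply/attacksP; exists e.
(* The case [c <-> d] is impossible: [e -> c] would make [d] and [e] attack each other, and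
   [c <-> e] would force [d <-> e] by simpliciality of [c]. *)
case/or3P: triec => [/nPce//|Pec|Sce].
  by case: (aa_noF aa Pde Sdc Pec Seb Pbd).
case: (aa_PS aa Pde); apply: simpc => //.
by apply: contraTneq Pde => ->; rewrite (aa_Pirr aa).
Qed.

Lemma simplicial_attacker (S P : rel T) (U : {set T}) a b :
    attack_antisym S P -> chordal S -> a \in U -> b \in U ->
    disimplicial_in S U a -> attacks S P U b a ->
  exists x, [/\ x \in U, disimplicial_in S U x & attacks S P U x a].
Proof.
move=> aa chS Ua Ub simpa /attacksP[c [Uc Sac Pab Pbc]].
have Sca : S c a by rewrite (aa_sym aa).
(* The attackers of [a] through the fixed witness [c]; they form a union of components away from [c]
   because [a] is simplicial and attacks are never mutual. *)
pose X := [set x in U | P a x && P x c].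
have [||||x] := @simplicial_away T S (aa_sym aa) chS U X c Uc.
- by apply/subsetP=> x /setIdP[].
- by apply/set0Pn; exists b; rewrite !inE Ub Pab.
- move=> x; rewrite inE => /and3P[_ _ Pxc]; split.
    by apply: contraTneq Pxc => ->; rewrite (aa_Pirr aa).
  by apply/negP; apply: aa_PS Pxc.
- move=> x y; rewrite !inE => /and3P[Ux Pax Pxc] Uy Sxy.
  have nPya : P y a -> False by apply: (aa_noF aa Pax Sac Pxc Sxy).
  case/or3P: (aa_triSP aa Pxc Sxy) => [Pcy|Pyc|]; last by rewrite (aa_sym aa); right.
    by case: (aa_noF aa Pxc Sxy Pcy Sca Pax).
  case/or3P: (aa_triPS aa Pax Sxy) => [Pay|/nPya//|Say].
    by left; rewrite Uy Pay.
  case: (aa_PS aa Pyc); apply: simpa => //; first by rewrite (aa_sym aa).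
  by apply: contraTneq Pyc => ->; rewrite (aa_Pirr aa).
rewrite inE => /and3P[Ux Pax Pxc] simpx; exists x; split=> //.
by apply/attacksP; exists c.
Qed.

Lemma unattacked_simplicial (S P : rel T) (U : {set T}) :
    attack_antisym S P -> chordal S -> U != set0 ->
  exists v, [/\ v \in U, disimplicial_in S U v &
    forall b, b \in U -> ~~ attacks S P U b v && ~~ rattacks S P U b v].
Proof.
move=> aa chS U0; have aar := attack_antisym_rev aa.
pose indeg x := #|[set a | P a x]|; pose outdeg x := #|[set a | P x a]|.
pose simp x := [forall u in U, forall w in U, [&& S u x, S x w & u != w] ==> S u w].
have simpP x : reflect (disimplicial_in S U x) (simp x).
  apply: (iffP idP) => [/forall_inP simpx u w Uu Uw Sux Sxw uw|simpx].
    by have /forall_inP/(_ w Uw) := simpx u Uu; rewrite Sux Sxw uw.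
  by apply/forall_inP=> u Uu; apply/forall_inP=> w Uw;
    apply/implyP => /and3P[]; apply: simpx.
pose M := [pred x | (x \in U) && simp x].
have MP x : x \in M -> x \in U /\ disimplicial_in S U x by case/andP=> ? /simpP.
pose M0 := [pred x in M | [forall (y | y \in M), ~~ attacks S P U y x]].
have [v1 Uv1 /simpP simpv1] := chS U U0.
have Mv1 : v1 \in M by rewrite inE Uv1.
(* Attacks raise the in-degree, so a simplicial vertex of maximum in-degree lies in [M0]. *)
have [v2 Mv2 maxv2] := arg_maxnP indeg Mv1.
have M0v2 : v2 \in M0.
  rewrite inE; apply/andP; split=> //; apply/forall_inP=> y My.
  apply/negP=> /(attacks_indegree aa); apply/negP; rewrite -leqNgt.
  exact: (maxv2 y My).
have [v M0v maxv] := arg_maxnP outdeg M0v2.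
have /andP[Mv /forall_inP nattv] : v \in M0 by [].
have [Uv simpv] := MP v Mv; exists v; split=> // b Ub; apply/andP; split.
  apply/negP=> /(simplicial_attacker aa chS Uv Ub simpv)[x [Ux /simpP simpx]].
  by apply/negP/nattv; rewrite inE Ux.
apply/negP=> /(simplicial_attacker aar chS Uv Ub simpv)[x [Ux /simpP simpx attx]].
(* A member [w] of [W] of maximum in-degree exceeds [v] in out-degree, hence is outside [M0]. Some
   [d] in [M] attacks it, and by composition [d] attacks [v] or is in [W] with larger in-degree. *)
pose W := [pred w in M | rattacks S P U w v].
have Wx : x \in W by rewrite inE; apply/andP; split; rewrite // inE Ux.
have [w /andP[Mw attw] maxw] := arg_maxnP indeg Wx.
have [/maxv/=|] := boolP (w \in M0).
  by rewrite /outdeg leqNgt (attacks_indegree aar attw).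
rewrite inE [w \in M]Mw => /forall_inPn[d Md /negbNE attd].
have [Ud simpd] := MP d Md.
case/orP: (attacks_comp aa Ud simpv attd attw) => [|attdv].
  exact/negP/nattv.
have /maxw/= : d \in W by rewrite inE; apply/andP.
by rewrite leqNgt (attacks_indegree aa attd).
Qed.

End Attacks.

(** * Translation between digraphs and attacks *)

Section Digraph.
Variables (T : finType) (A : rel T).
Hypothesis A_irr : irreflexive A.

Definition pure_part : rel T := fun u v => A u v && ~~ A v u.

Lemma chordal_sym_part : chordal A -> chordal (sym_part A).
Proof.
move=> chA U /chA[v Uv simpv]; exists v => // u w Uu Uw /andP[Auv Avu] /andP[Avw Awv] uw.
by apply/andP; split; apply: simpv; rewrite // eq_sym.
Qed.

Lemma chordal_induced n (F : rel 'I_n.+1) :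
  chordal A -> has_induced A F ->
  exists i, forall j k, F j i -> F i k -> j != k -> F j k.
Proof.
move=> chA [f [injf AF]].
have [|v /imsetP[i _ ->] simpv] := chA (f @: setT).
  by apply/set0Pn; exists (f ord0); apply: imset_f.
exists i => j k; rewrite -!AF => Fji Fik jk; apply: simpv; rewrite ?imset_f //.
by rewrite (inj_eq injf).
Qed.

(** Injectivity is automatic: a collision would give a loop. *)
Lemma semicomplete_induced n (F : rel 'I_n) (f : 'I_n -> T) :
    (forall i j, i != j -> F i j || F j i) ->
    (forall i j, A (f i) (f j) = F i j) ->
  has_induced A F.
Proof.
move=> adjF AF; exists f; split=> // i j eqf.
by apply/eqP; apply: contraT => /adjF; rewrite -!AF eqf A_irr.
Qed.

Lemma tri_adjacent u v : tri (sym_part A) pure_part u v = adjacent A u v.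
Proof. by rewrite /tri /sym_part /pure_part /adjacent; do 2!case: (A _ _). Qed.

Lemma wqt_attack_antisym :
    weakly_quasi_transitive A ->
    ~ has_induced A F_a -> ~ has_induced A F_b -> ~ has_induced A F_c ->
    ~ has_induced A F_d ->
  attack_antisym (sym_part A) pure_part.
Proof.
move=> wqt nFa nFb nFc nFd.
have triP u v w : asynchronous A v u w -> tri (sym_part A) pure_part u w.
  by rewrite tri_adjacent; apply: wqt.
have triSP u v w : pure_part v u -> sym_part A v w ->
    tri (sym_part A) pure_part u w.
  move=> /andP[vu uv] /andP[vw wv]; apply: (triP u v w); split.
    by rewrite /adjacent vu.
  by rewrite /adjacent /nb_class vu vw wv (negPf uv).
have triPS u v w : pure_part u v -> sym_part A v w ->
    tri (sym_part A) pure_part u w.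
  move=> /andP[uv vu] /andP[vw wv]; apply: (triP u v w); split.
    by rewrite /adjacent uv orbT.
  by rewrite /adjacent /nb_class uv vw wv (negPf vu).
split=> //.
- by move=> x y; rewrite /sym_part andbC.
- by move=> x; rewrite /pure_part A_irr.
- by move=> x y /andP[_ /negPf yx]; rewrite /sym_part yx andbF.
- move=> u v w /andP[uv vu] /andP[vw wv]; apply: (triP u v w); split.
    by rewrite /adjacent uv orbT.
  by rewrite /adjacent /nb_class uv vw (negPf wv) (negPf vu).
- move=> u v w /andP[uv /negPf vu] /andP[vw /negPf wv] /andP[wu /negPf uw].
  apply: nFd; apply: (@semicomplete_induced _ _ (nth u [:: u; v; w])).
    by do 2!case=> [[|[|[|?]]] ?].
  by do 2!case=> [[|[|[|?]]] ?] //=; rewrite A_irr.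
move=> a b c d /andP[ab /negPf ba] /[dup] Sac /andP[ac ca].
move=> /andP[bc /negPf cb] /andP[bd db] /[dup] Pda /andP[da /negPf ad].
(* Only the arcs between [c] and [d] are left open; their three possible forms give [F_a], [F_b] and
   [F_c], with [a], [b], [c], [d] as vertices 1 to 4. *)
have /orP cd : adjacent A c d.
  by move: (triPS d a c Pda Sac); rewrite tri_adjacent /adjacent orbC.
have [Acd|/negPf Acd] := boolP (A c d); have [Adc|/negPf Adc] := boolP (A d c).
- apply: nFa; apply: (@semicomplete_induced _ _ (nth a [:: a; b; c; d])).
    by do 2!case=> [[|[|[|[|?]]]] ?].
  by do 2!case=> [[|[|[|[|?]]]] ?] //=; rewrite A_irr.
- apply: nFb; apply: (@semicomplete_induced _ _ (nth a [:: a; b; c; d])).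
    by do 2!case=> [[|[|[|[|?]]]] ?].
  by do 2!case=> [[|[|[|[|?]]]] ?] //=; rewrite A_irr.
- apply: nFc; apply: (@semicomplete_induced _ _ (nth a [:: a; b; c; d])).
    by do 2!case=> [[|[|[|[|?]]]] ?].
  by do 2!case=> [[|[|[|[|?]]]] ?] //=; rewrite A_irr.
by case: cd; rewrite ?Acd ?Adc.
Qed.

(** Suppose [u -> v -> w] without [u -> w]. If both arcs are symmetric, simpliciality fails; if
    exactly one is, [w] or [u] attacks [v]; if neither is, a directed triangle appears. *)
Lemma unattacked_disimplicial (U : {set T}) v :
    attack_antisym (sym_part A) pure_part -> v \in U ->
    disimplicial_in (sym_part A) U v ->
    (forall b, b \in U -> ~~ attacks (sym_part A) pure_part U b v &&
                          ~~ rattacks (sym_part A) pure_part U b v) ->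
  disimplicial_in A U v.
Proof.
move=> aa Uv simpv natt u w Uu Uw Auv Avw uw; apply: contraT => Auw.
have symP x y : A x y -> A y x -> sym_part A x y by move=> *; apply/andP.
have pureP x y : A x y -> ~~ A y x -> pure_part x y by move=> *; apply/andP.
have Pwu : tri (sym_part A) pure_part u w -> pure_part w u.
  by rewrite tri_adjacent /adjacent (negPf Auw) => Awu; apply: pureP.
have [Avu|Avu] := boolP (A v u); have [Awv|Awv] := boolP (A w v).
- have /andP[] : sym_part A u w by apply: simpv => //; apply: symP.
  by rewrite (negPf Auw).
- have /andP[/attacksP[]] := natt w Uw; exists u; split=> //; [exact: symP | exact: pureP |].
  apply: Pwu; rewrite tri_adjacent /adjacent orbC -/(adjacent A w u) -tri_adjacent.
  by apply: (aa_triSP aa (pureP _ _ Avw Awv)); apply: symP.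
- have /andP[_ /attacksP[]] := natt u Uu; exists w; split=> //; [exact: symP | exact: pureP |].
  by apply: Pwu; apply: (aa_triPS aa (pureP _ _ Auv Avu)); apply: symP.
have Puv := pureP _ _ Auv Avu; have Pvw := pureP _ _ Avw Awv.
by case: (aa_nocycle aa Puv Pvw); apply: Pwu; apply: (aa_triPP aa Puv Pvw).
Qed.

(** Chordality would give an induced copy a di-simplicial vertex, and none of the four digraphs has
    one. *)
Lemma F_not_induced : chordal A ->
  ~ has_induced A F_a /\ ~ has_induced A F_b /\
  ~ has_induced A F_c /\ ~ has_induced A F_d.
Proof.
have wit n (F : rel 'I_n.+1) (g : 'I_n.+1 -> 'I_n.+1 * 'I_n.+1) : chordal A ->
    (forall i, [&& F (g i).1 i, F i (g i).2, (g i).1 != (g i).2 & ~~ F (g i).1 (g i).2]) ->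
    ~ has_induced A F.
  move=> chA gP /(chordal_induced chA)[i] /(_ (g i).1 (g i).2).
  by case/and4P: (gP i) => -> -> -> /negPf-> /(_ isT isT isT).
pose o4 k lt_k := @Ordinal 4 k lt_k; pose o3 k lt_k := @Ordinal 3 k lt_k.
move=> chA; do !split.
(* Each list gives, vertex by vertex, an in- and an out-neighbour not joined by
   an arc; the default serves the remaining vertices. *)
- apply: (wit _ _ (fun i => nth (o4 1 isT, o4 0 isT)
    [:: (o4 2 isT, o4 1 isT); (o4 0 isT, o4 3 isT); (o4 0 isT, o4 3 isT)] i)) => //.
  by case=> [[|[|[|[|?]]]] ?].
- apply: (wit _ _ (fun i => nth (o4 1 isT, o4 0 isT)
    [:: (o4 2 isT, o4 1 isT); (o4 0 isT, o4 3 isT)] i)) => //.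
  by case=> [[|[|[|[|?]]]] ?].
- apply: (wit _ _ (fun i => nth (o4 1 isT, o4 0 isT)
    [:: (o4 2 isT, o4 1 isT); (o4 0 isT, o4 3 isT)] i)) => //.
  by case=> [[|[|[|[|?]]]] ?].
- apply: (wit _ _ (fun i => nth (o3 1 isT, o3 0 isT)
    [:: (o3 2 isT, o3 1 isT); (o3 0 isT, o3 2 isT)] i)) => //.
  by case=> [[|[|[|?]]] ?].
Qed.

End Digraph.

Theorem theorem3p3 (T : finType) (A : rel T) (noloop : irreflexive A) :
  weakly_quasi_transitive A ->
  (chordal A <->
   (chordal (sym_part A) /\
    ~ has_induced A F_a /\ ~ has_induced A F_b /\
    ~ has_induced A F_c /\ ~ has_induced A F_d)).
Proof.
move=> wqt; split=> [chA | [chS [nFa [nFb [nFc nFd]]]] U U0].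
  by split; [apply: chordal_sym_part | apply: F_not_induced].
have aa := wqt_attack_antisym noloop wqt nFa nFb nFc nFd.
have [v [Uv simpv natt]] := unattacked_simplicial aa chS U0.
by exists v => //; apply: unattacked_disimplicial natt.
Qed.
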